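(* Let $T$ be a Lie triple system over a field $\mathbb{F}$ that is either a two-dimensional simple Lie triple system or an abelian Lie triple system. Then $\mathrm{QDer}(T)=\mathrm{End}(T)$.
   Context: A Lie triple system over a field $\mathbb{F}$ is a vector space $T$ over $\mathbb{F}$ with a trilinear map $[\cdot,\cdot,\cdot]:T\times T\times T\to T$ such that for all $x,y,z,u,v\in T$: $[x,x,z]=0$; $[x,y,z]+[y,z,x]+[z,x,y]=0$; $[x,y,[z,u,v]]=[[x,y,z],u,v]+[z,[x,y,u],v]+[z,u,[x,y,v]]$. $\mathrm{End}(T)$ is the set of all linear maps $T\to T$. $[T,T,T]$ is the linear span of all $[x,y,z]$. A map $D\in\mathrm{End}(T)$ is a quasiderivation if there exists $D'\in\mathrm{End}(T)$ with $[D(x),y,z]+[x,D(y),z]+[x,y,D(z)]=D'([x,y,z])$ for all $x,y,z\in T$; $\mathrm{QDer}(T)$ is the set of quasiderivations. $T$ is abelian if $[x,y,z]=0$ for all $x,y,z\in T$. An ideal of $T$ is a subspace $I$ with $[I,T,T]\subseteq I$; $T$ is simple if $[T,T,T]\neq 0$ and its only ideals are $\{0\}$ and $T$. *)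

(* Defs.v *)
From HB Require Import structures.
From mathcomp Require Import all_boot all_order all_algebra.
From mathcomp Require Import boolp classical_sets.

Set Implicit Arguments.
Unset Strict Implicit.
Unset Printing Implicit Defensive.

Import GRing.Theory.

Local Open Scope classical_set_scope.
Local Open Scope ring_scope.

HB.mixin Record isLieTripleSystem (F : fieldType) (T : Type)
    of GRing.Lmodule F T := {
  lts : T -> T -> T -> T;
  lts_linear1 : forall y z : T, linear (fun x => lts x y z);
  lts_linear2 : forall x z : T, linear (fun y => lts x y z);
  lts_linear3 : forall x y : T, linear (fun z => lts x y z);
  ltsxx : forall x z : T, lts x x z = 0;
  lts_cyclic : forall x y z : T, lts x y z + lts y z x + lts z x y = 0;
  lts_derivation : forall x y z u v : T,
    lts x y (lts z u v) =
    lts (lts x y z) u v + lts z (lts x y u) v + lts z u (lts x y v)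
}.

#[short(type="lieTripleSystemType")]
HB.structure Definition LieTripleSystem (F : fieldType) :=
  {T of GRing.Lmodule F T & isLieTripleSystem F T}.

Section LinearAlgebra.
Variables (F : fieldType) (V : lmodType F).

Definition is_subspace (A : set V) : Prop := submod_closed (mem A).

Definition linear_span (A : set V) : set V := smallest is_subspace A.

Definition is_basis n (e : 'I_n -> V) : Prop :=
  (forall c : 'I_n -> F, \sum_(i < n) c i *: e i = 0 -> forall i, c i = 0) /\
  linear_span (range e) = setT.

(* [V] need not be finite-dimensional, so it is not assumed to be a
   [vectType] and its dimension is expressed by the existence of a basis. *)
Definition has_dim n : Prop := exists e : 'I_n -> V, is_basis e.

End LinearAlgebra.

Arguments has_dim [F] V n.

Section LieTripleSystemTheory.
Variables (F : fieldType) (T : lieTripleSystemType F).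

Definition lts_prod (A B C : set T) : set T :=
  linear_span [set w | exists x y z, [/\ A x, B y, C z & w = lts x y z]].

Definition abelian : Prop := forall x y z : T, lts x y z = 0.

Definition ideal (I : set T) : Prop :=
  is_subspace I /\ lts_prod I setT setT `<=` I.

Definition simple : Prop :=
  lts_prod setT setT setT <> [set 0] /\
  forall I : set T, ideal I -> I = [set 0] \/ I = setT.

Definition quasiderivation (D : {linear T -> T}) : Prop :=
  exists D' : {linear T -> T}, forall x y z : T,
    lts (D x) y z + lts x (D y) z + lts x y (D z) = D' (lts x y z).

Definition QDer : set {linear T -> T} := [set D | quasiderivation D].

End LieTripleSystemTheory.

Arguments abelian [F] T.
Arguments simple [F] T.
Arguments QDer [F] T.

(* Main.v *)
Require Import Defs.
From HB Require Import structures.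
From mathcomp Require Import all_boot all_order all_algebra.
From mathcomp Require Import boolp classical_sets.

(** If [T] is abelian, both sides of the quasiderivation equation vanish and
    [D' = 0] works for every [D].

    Suppose that [T] is simple with basis [e 0, e 1].  The bracket is
    alternating and bilinear in its first two arguments, and on a plane such
    a map is the determinant times its value at [(e 0, e 1)]
    ([alternating_det2]).  Hence [[x, y, z] = det(x, y) A z], where
    [A z = [e 0, e 1, z]].  Given [D], the expression
    [Q x y z = [D x, y, z] + [x, D y, z] + [x, y, D z]] is alternating in
    [x, y] as well, so [Q x y z = det(x, y) Q (e 0) (e 1) z].  It therefore
    suffices to find a linear [D'] with [D' (A z) = Q (e 0) (e 1) z], which
    exists as soon as [A] is invertible.  Now [[T, T, T]] is a nonzero ideal,
    hence all of [T] ([simple_lts_prod]); it is contained in the image of [A],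
    so that [A] is onto, and a surjective endomorphism of a
    finite-dimensional space is invertible ([surjective_linear_inverse]). *)

Set Implicit Arguments.
Unset Strict Implicit.
Unset Printing Implicit Defensive.

Import GRing.Theory.

Local Open Scope classical_set_scope.
Local Open Scope ring_scope.

Section Subspaces.
Variables (F : fieldType) (V : lmodType F).

Lemma is_subspaceP (A : set V) :
  is_subspace A <-> A 0 /\ (forall a u v, A u -> A v -> A (a *: u + v)).
Proof.
split=> -[A0 AD]; split.
- by have := A0; rewrite inE.
- by move=> a u v Au Av; have := AD a u v; rewrite !inE; apply.
- by rewrite inE.
- by move=> a u v; rewrite !inE; apply: AD.
Qed.

Lemma is_subspace_span (A : set V) : is_subspace (linear_span A).
Proof.
apply/is_subspaceP; split=> [|a u v Au Av] B [sB AB].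
  by case/is_subspaceP: sB.
have /is_subspaceP[_ BD] := sB.
by apply: BD; [apply: Au | apply: Av].
Qed.

Lemma is_subspace_range (W : lmodType F) (f : W -> V) :
  linear f -> is_subspace (range f).
Proof.
move=> flin; pose g : {linear W -> V} :=
  HB.pack f (GRing.isLinear.Build _ _ _ _ f flin).
apply/is_subspaceP; split=> [|a _ _ [u _ <-] [v _ <-]].
  by exists 0 => //; rewrite -[f]/(g : W -> V) linear0.
by exists (a *: u + v) => //; rewrite flin.
Qed.

End Subspaces.

Section Coordinates.
Variables (F : fieldType) (V : lmodType F) (n : nat) (e : 'I_n -> V).
Hypothesis e_basis : is_basis e.

Definition lincomb (r : 'rV[F]_n) : V := \sum_(i < n) r 0 i *: e i.

Lemma lincomb_is_linear : linear lincomb.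
Proof.
move=> a u v; rewrite /lincomb scaler_sumr -big_split /=.
by apply: eq_bigr => i _; rewrite !mxE scalerDl scalerA.
Qed.

HB.instance Definition _ :=
  GRing.isLinear.Build F 'rV[F]_n V *:%R lincomb lincomb_is_linear.

Lemma lincomb_surj x : exists r, lincomb r = x.
Proof.
have [_ espan] := e_basis.
have : linear_span (range e) x by rewrite espan.
case/(_ (range lincomb)) => [|r _ <-]; last by exists r.
split; first exact: is_subspace_range lincomb_is_linear.
move=> _ [i _ <-]; exists (delta_mx 0 i) => //.
rewrite /lincomb (bigD1 i) //= !mxE !eqxx scale1r big1 ?addr0 // => j jDi.
by rewrite mxE (negPf jDi) andbF scale0r.
Qed.

Definition coords (x : V) : 'rV[F]_n := sval (cid (lincomb_surj x)).

Lemma coordsK : cancel coords lincomb.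
Proof. by move=> x; rewrite /coords; case: cid. Qed.

Lemma lincombK : cancel lincomb coords.
Proof.
move=> r; apply/eqP; rewrite -subr_eq0; apply/eqP/rowP => i; rewrite [RHS]mxE.
have [efree _] := e_basis; apply: efree.
by rewrite -/(lincomb _) linearB /= coordsK subrr.
Qed.

Lemma coords_is_linear : linear coords.
Proof.
by move=> a u v; rewrite -{1}[u]coordsK -{1}[v]coordsK -linearP lincombK.
Qed.

HB.instance Definition _ :=
  GRing.isLinear.Build F V 'rV[F]_n *:%R coords coords_is_linear.

(** Preimages of the basis vectors give a linear right inverse; in coordinates
    it is also a left inverse, because one-sided inverses of square matrices
    are two-sided. *)
Lemma surjective_linear_inverse (f : {linear V -> V}) :
  range f = setT -> exists g : {linear V -> V}, cancel f g.
Proof.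
move=> fsurj.
have /choice[h hK] y : exists x, f x = y.
  have : range f y by rewrite fsurj.
  by case=> x _ <-; exists x.
pose M := lin1_mx (coords \o f \o lincomb).
pose N := \matrix_i coords (h (lincomb (delta_mx 0 i))).
have NM : N *m M = 1%:M.
  apply/row_matrixP => i.
  by rewrite row_mul rowK mul_rV_lin1 /= coordsK hK lincombK row1.
have MN : M *m N = 1%:M by apply: mulmx1C.
exists (lincomb \o mulmxr N \o coords) => x /=.
rewrite -[in RHS](coordsK x); congr lincomb.
have -> : coords (f x) = coords x *m M by rewrite mul_rV_lin1 /= coordsK.
by rewrite -mulmxA MN mulmx1.
Qed.

End Coordinates.

Section AlternatingPlane.
Variables (F : fieldType) (V W : lmodType F) (e : 'I_2 -> V).
Hypothesis e_basis : is_basis e.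

Definition det2 (x y : V) : F :=
  let r := coords e_basis x in let s := coords e_basis y in
  r 0 0 * s 0 1 - r 0 1 * s 0 0.

(** Expanding both arguments in the basis leaves four terms: alternation kills
    the two diagonal ones and, by polarization, makes the other two opposite,
    whatever the characteristic. *)
Lemma alternating_det2 (phi : V -> V -> W) :
  (forall y, linear (phi^~ y)) -> (forall x, linear (phi x)) ->
  (forall x, phi x x = 0) ->
  forall x y, phi x y = det2 x y *: phi (e 0) (e 1).
Proof.
move=> lin1 lin2 alt x y.
pose phil y : {linear V -> W} :=
  HB.pack (phi^~ y) (GRing.isLinear.Build _ _ _ _ (phi^~ y) (lin1 y)).
pose phir x : {linear V -> W} :=
  HB.pack (phi x) (GRing.isLinear.Build _ _ _ _ (phi x) (lin2 x)).
have philD z a u b v : phi (a *: u + b *: v) z = a *: phi u z + b *: phi v z.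
  by rewrite -[LHS]/(phil z _) linearD !linearZ.
have phirD z a u b v : phi z (a *: u + b *: v) = a *: phi z u + b *: phi z v.
  by rewrite -[LHS]/(phir z _) linearD !linearZ.
have skew : phi (e 1) (e 0) = - phi (e 0) (e 1).
  apply/eqP; rewrite -addr_eq0; apply/eqP.
  have := alt (1 *: e 0 + 1 *: e 1).
  by rewrite philD !phirD !alt !scale1r add0r addr0 addrC.
have expand z : z = coords e_basis z 0 0 *: e 0 + coords e_basis z 0 1 *: e 1.
  rewrite -[LHS](coordsK e_basis) /lincomb big_ord_recl big_ord1.
  by congr (_ + coords _ _ _ _ *: e _); apply: val_inj.
rewrite [x in LHS]expand [y in LHS]expand philD !phirD !alt skew.
rewrite !scaler0 add0r addr0 scalerN scalerA scalerN scalerA -scaleNr.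
by rewrite -scalerDl.
Qed.

End AlternatingPlane.

Section TripleSystems.
Variables (F : fieldType) (T : lieTripleSystemType F).

HB.instance Definition _ (x y : T) :=
  GRing.isLinear.Build F T T *:%R (lts x y) (lts_linear3 x y).

Lemma lts_antisym (x y z : T) : lts x y z + lts y x z = 0.
Proof.
have add1 u v w : lts (u + v) w z = lts u w z + lts v w z.
  by have := lts_linear1 w z 1 u v; rewrite !scale1r.
have add2 u v w : lts w (u + v) z = lts w u z + lts w v z.
  by have := lts_linear2 w z 1 u v; rewrite !scale1r.
by have := ltsxx (x + y) z; rewrite add1 !add2 !ltsxx add0r addr0.
Qed.

(** [[T, T, T]] absorbs every bracket, so it is an ideal; simplicity excludes
    that it is zero. *)
Lemma simple_lts_prod : simple T -> lts_prod setT setT setT = [set: T].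
Proof.
case=> prod_neq0 ideals.
have : ideal (lts_prod setT setT [set: T]).
  split; first exact: is_subspace_span.
  move=> w; apply: sub_smallest2r => [|_ [x [y [z [_ _ _ ->]]]]].
    exact: is_subspace_span.
  by exists x, y, z.
by case/ideals.
Qed.

Lemma abelian_quasiderivation (D : {linear T -> T}) :
  abelian T -> quasiderivation D.
Proof.
by move=> abT; exists \0 => x y z; rewrite !abT !addr0.
Qed.

Lemma simple_dim2_quasiderivation (D : {linear T -> T}) :
  has_dim T 2 -> simple T -> quasiderivation D.
Proof.
move=> [e e_basis] simpleT.
have ltsE x y z : lts x y z = det2 e_basis x y *: lts (e 0) (e 1) z.
  apply: (alternating_det2 e_basis (phi := fun x y => lts x y z)).
  - by move=> v; apply: lts_linear1.
  - by move=> u; apply: lts_linear2.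
  - by move=> u; apply: ltsxx.
pose A : {linear T -> T} := lts (e 0) (e 1).
have A_surj : range A = setT.
  apply/seteqP; split=> // w _.
  have : lts_prod setT setT setT w by rewrite simple_lts_prod.
  apply; split; first exact: is_subspace_range (@linearP _ _ _ _ A).
  move=> _ [x [y [z [_ _ _ ->]]]].
  by exists (det2 e_basis x y *: z) => //; rewrite linearZ /= -ltsE.
have [B AK] := surjective_linear_inverse e_basis A_surj.
pose Q x y z := lts (D x) y z + lts x (D y) z + lts x y (D z).
have QE x y z : Q x y z = det2 e_basis x y *: Q (e 0) (e 1) z.
  apply: (alternating_det2 e_basis (phi := fun x y => Q x y z)).
  - move=> v a u u'; rewrite /Q linearP !lts_linear1 !scalerDr.
    by rewrite [RHS]addrACA [X in _ = X + _]addrACA.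
  - move=> v a u u'; rewrite /Q linearP !lts_linear2 !scalerDr.
    by rewrite [RHS]addrACA [X in _ = X + _]addrACA.
  - by move=> u; rewrite /Q ltsxx addr0 lts_antisym.
have Qlin : linear (Q (e 0) (e 1)).
  move=> a u v; rewrite /Q !linearP !scalerDr.
  by rewrite [RHS]addrACA [X in _ = X + _]addrACA.
pose Q01 : {linear T -> T} :=
  HB.pack (Q (e 0) (e 1)) (GRing.isLinear.Build _ _ _ _ (Q (e 0) (e 1)) Qlin).
exists (Q01 \o B) => x y z.
rewrite -/(Q x y z) QE ltsE linearZ /=; congr (_ *: Q _ _ _).
by rewrite -[lts _ _ z]/(A z) AK.
Qed.

End TripleSystems.

Theorem theorem3p5 (F : fieldType) (T : lieTripleSystemType F)
  (hT : (has_dim T 2%N /\ simple T) \/ abelian T) :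
  QDer T = [set: {linear T -> T}].
Proof.
apply/seteqP; split=> // D _.
case: hT => [[dimT simpleT]|abT].
  exact: simple_dim2_quasiderivation.
exact: abelian_quasiderivation.
Qed.
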